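(* For every integer $n\ge 1$, the Bernstein operator $B_n$ on $[0,\pi]$ preserves positive-definiteness on the circle $S^1$; that is, if $f:[0,\pi]\to\mathbb{R}$ is continuous and positive-definite on $S^1$, then $B_n[f]:[0,\pi]\to\mathbb{R}$ is also positive-definite on $S^1$.
   Context: Let $d_{S^1}$ denote geodesic distance on the unit circle $S^1$, normalized so that $d_{S^1}(z,w)\in[0,\pi]$. A continuous function $f:[0,\pi]\to\mathbb{R}$ is called positive-definite on $S^1$ if for every finite set of points $z_1,\ldots,z_N\in S^1$ the matrix $\bigl(f(d_{S^1}(z_p,z_q))\bigr)_{p,q=1}^N$ is positive semidefinite (not necessarily strictly positive definite). Equivalently, by the Bochner--Schoenberg characterization, $f$ has a uniformly convergent cosine expansion $f(x)=\frac{b_0}{2}+\sum_{m=1}^\infty b_m\cos(mx)$ with $b_m\ge 0$ for all $m\ge0$ and $\sum_{m=0}^\infty b_m<\infty$, where $b_m=\frac{2}{\pi}\int_0^\pi f(x)\cos(mx)\,dx$. For an integer $n\ge1$, the Bernstein operator on $[0,\pi]$ is $$B_n[f](x)=\sum_{j=0}^{n}\binom{n}{j}\Bigl(\frac{x}{\pi}\Bigr)^j\Bigl(1-\frac{x}{\pi}\Bigr)^{n-j} f\Bigl(\frac{j\pi}{n}\Bigr),\qquad 0\le x\le\pi.$$ *)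

(* Defs.v *)
From mathcomp Require Import all_boot all_order all_algebra.
From mathcomp Require Import all_classical all_reals all_analysis.
From mathcomp Require Import lra.

Set Implicit Arguments.
Unset Strict Implicit.
Unset Printing Implicit Defensive.

Import Order.TTheory GRing.Theory Num.Theory.
Import numFieldNormedType.Exports.

Local Open Scope classical_set_scope.
Local Open Scope ring_scope.

Definition unit_circle (R : realType) : set (R * R) :=
  [set z | z.1 ^+ 2 + z.2 ^+ 2 = 1].

(* On the circle, the length of the shorter arc from [z] to [w] is the angle in
   [0, pi] between the unit vectors [z] and [w]; junk off [unit_circle]. *)
Definition circle_dist (R : realType) (z w : R * R) : R :=
  acos (z.1 * w.1 + z.2 * w.2).

Definition psdmx (R : realType) (N : nat) (A : 'M[R]_N) : Prop :=
  A^T = A /\ forall u : 'rV[R]_N, 0 <= (u *m A *m u^T) 0 0.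

(* A function on [0, pi] is encoded by a total function [f : R -> R] of which
   only the restriction to [0, pi] matters.  The points [z p] are not required
   to be distinct: merging equal points by adding their weights shows that
   repetitions do not affect the condition. *)
Definition positive_definite_S1 (R : realType) (f : R -> R) : Prop :=
  {within `[0, pi], continuous f} /\
  forall (N : nat) (z : 'I_N -> R * R), (forall p, unit_circle (z p)) ->
    psdmx (\matrix_(p, q) f (circle_dist (z p) (z q))).

Definition bernstein (R : realType) (n : nat) (f : R -> R) : R -> R :=
  fun x => \sum_(j < n.+1)
    'C(n, j)%:R * (x / pi) ^+ j * (1 - x / pi) ^+ (n - j) *
    f (j%:R * pi / n%:R).

Lemma circle_dist_itv (R : realType) (z w : R * R) :
  unit_circle z -> unit_circle w -> 0 <= circle_dist z w <= pi.
Proof.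
rewrite /unit_circle /circle_dist /= => hz hw.
set t := _ + _; have ht : -1 <= t <= 1.
  have hD := addr_ge0 (sqr_ge0 (z.1 + w.1)) (sqr_ge0 (z.2 + w.2)).
  have hB := addr_ge0 (sqr_ge0 (z.1 - w.1)) (sqr_ge0 (z.2 - w.2)).
  by rewrite /t; apply/andP; split; lra.
by rewrite acos_ge0 ?acos_lepi.
Qed.

Lemma circle_dist_angle (R : realType) (s t : R) : `|s - t| <= pi ->
  circle_dist (cos s, sin s) (cos t, sin t) = `|s - t|.
Proof.
move=> st; rewrite /circle_dist /= -cosB -cos_norm.
by rewrite cosK// in_itv/= normr_ge0.
Qed.

(* Main.v *)
Require Import Defs.
From mathcomp Require Import all_boot all_order all_algebra.
From mathcomp Require Import all_classical all_reals all_analysis.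
From mathcomp Require Import ring lra zify.

(** Work with angles measured in units of [pi], so that the points are
    [exp (i pi s_p)].  Round the reals [s_p] to integers [a_p(v)], the integer
    part of [s_p] plus one if the threshold [v] lies below the fractional part,
    with the same uniform [v] in [0, 1] for all [p].  Each difference
    [a_p(v) - a_q(v)] takes only the two integer values [l] and [l + 1] that
    enclose [s_p - s_q], and its mean is [s_p - s_q] ([integer_rounding]).
    Round [n] times with independent thresholds.  The sum of the [n] differences
    is then [l n] plus a binomial variable of parameter [s_p - s_q - l], so the
    Bernstein polynomial is an expectation:

      [B_n f (dist (z_p, z_q)) = E (F (A_p - A_q))],

    where [A_p] is the sum of the [n] roundings of [s_p] and [F a] is the value
    of [f] at the circular distance from [1] to the [2n]-th root of unity
    [exp (i pi a / n)] ([bernstein_acos_cos]).  For every outcome of the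
    thresholds, [F (A_p - A_q)] is the matrix of [f] at the points
    [exp (i pi A_p / n)], hence is positive semidefinite by hypothesis; an
    average of such matrices is positive semidefinite too
    ([binomial_mean_kernel]).

    Only finitely many thresholds matter, those separating the sorted
    fractional parts, so the uniform law is replaced by a finite convex
    combination ([threshold_average]), and the [n] independent roundings are
    averaged one at a time through the Pascal recursion of the binomial law
    ([binomial_meanS]). *)

Set Implicit Arguments.
Unset Strict Implicit.
Unset Printing Implicit Defensive.

Import Order.TTheory GRing.Theory Num.Theory.
Import numFieldNormedType.Exports.

Local Open Scope classical_set_scope.
Local Open Scope ring_scope.

(** The mean of [g] under the binomial law with [k] trials and success
    probability [r]. *)
Definition binomial_mean (R : comPzRingType) (k : nat) (r : R) (g : nat -> R) : R :=
  \sum_(j < k.+1) 'C(k, j)%:R * r ^+ j * (1 - r) ^+ (k - j) * g j.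

Lemma eq_binomial_mean (R : comPzRingType) (k : nat) (r : R) (g h : nat -> R) :
  (forall j, (j <= k)%N -> g j = h j) ->
  binomial_mean k r g = binomial_mean k r h.
Proof.
by move=> gh; apply: eq_bigr => j _; rewrite gh // -ltnS.
Qed.

(** Conditioning on the first of [k + 1] independent trials. *)
Lemma binomial_meanS (R : comPzRingType) (k : nat) (r : R) (g : nat -> R) :
  binomial_mean k.+1 r g =
  (1 - r) * binomial_mean k r g + r * binomial_mean k r (fun j => g j.+1).
Proof.
rewrite /binomial_mean !mulr_sumr big_ord_recl [in RHS]big_ord_recl /=.
under eq_bigr => j _ do
  rewrite /bump /= add1n binS natrD subSS !mulrDl.
rewrite big_split /= big_ord_recr /=.
rewrite (@bin_small k k.+1) // !mul0r addr0.
rewrite !addrA; congr (_ + _ + _).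
- by rewrite !bin0 !subn0 exprS; ring.
- apply: eq_bigr => j _; rewrite /bump /= add1n.
  have -> : (k - j = (k - j.+1).+1)%N by rewrite subnSK.
  by rewrite !exprS; ring.
- by apply: eq_bigr => j _; rewrite exprS; ring.
Qed.

(** Exchange of success and failure. *)
Lemma binomial_mean_rev (R : comPzRingType) (k : nat) (r : R) (g : nat -> R) :
  binomial_mean k r g = binomial_mean k (1 - r) (fun j => g (k - j)%N).
Proof.
rewrite /binomial_mean (reindex_inj rev_ord_inj) /=.
apply: eq_bigr => j _; have jk : (j <= k)%N by rewrite -ltnS.
by rewrite subSS bin_sub // subKn // (_ : 1 - (1 - r) = r); ring.
Qed.

(** A discrete stand-in for a uniform threshold in [0, 1]: the values [x p]
    together with [0] and [1] cut the interval into pieces, each represented by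
    its left end [t i] with weight its length, and [x p] is the total length of
    the pieces to its left. *)
Lemma threshold_average (R : realDomainType) (N : nat) (x : 'I_N -> R) :
  (forall p, 0 <= x p <= 1) ->
  exists (m : nat) (w t : 'I_m -> R),
    [/\ forall i, 0 <= w i, \sum_i w i = 1
      & forall p, \sum_i w i * (t i < x p)%R%:R = x p].
Proof.
move=> x01; pose v := sort <=%R [:: 0, 1 & codom x].
have sz : size v = N.+2 by rewrite size_sort /= size_codom card_ord.
have v_mono i j : (i <= j < N.+2)%N -> v`_i <= v`_j.
  move=> /andP[ij jN]; apply: (sorted_leq_nth le_trans le_refl 0) => //.
  - exact: sort_le_sorted.
  - by rewrite inE sz; lia.
  - by rewrite inE sz.
have v_idx y : y \in [:: 0, 1 & codom x] -> exists2 i, (i < N.+2)%N & v`_i = y.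
  rewrite -(mem_sort <=%R) => yv; exists (index y v); last exact: nth_index.
  by rewrite -sz index_mem.
have v01 i : (i < N.+2)%N -> 0 <= v`_i <= 1.
  rewrite -sz => iN; have := mem_nth 0 iN; rewrite mem_sort !inE.
  by case/or3P => [/eqP->|/eqP->|/codomP[p ->] //]; rewrite lexx ler01.
have v0 : v`_0 = 0.
  have [|i iN vi] := v_idx 0; first by rewrite inE eqxx.
  have := v_mono 0%N i; have := v01 0%N.
  by rewrite vi iN => /(_ isT) ? /(_ isT) ?; lra.
have v1 : v`_N.+1 = 1.
  have [|i iN vi] := v_idx 1; first by rewrite !inE eqxx orbT.
  have := v_mono i N.+1; have := v01 N.+1.
  by rewrite vi ltnSn -ltnS iN => /(_ isT) ? /(_ isT) ?; lra.
exists N.+1, (fun i => v`_i.+1 - v`_i), (fun i => v`_i); split => [i||p].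
- by rewrite subr_ge0 v_mono // leqnSn /= ltnS ltn_ord.
- rewrite -(big_mkord xpredT (fun i => v`_i.+1 - v`_i)) telescope_sumr //.
  by rewrite v0 v1 subr0.
(* No [x p] lies strictly inside a piece, so truncating the pieces at [x p]
   keeps or kills each one entirely, and the truncated lengths telescope. *)
have [|k kN vk] := v_idx (x p); first by rewrite !inE codom_f !orbT.
have [x0 x1] := andP (x01 p).
transitivity (Num.min v`_N.+1 (x p) - Num.min v`_0 (x p)); last first.
  by rewrite v0 v1 (min_idPr x1) (min_idPl x0) subr0.
rewrite -(telescope_sumr (fun i => Num.min v`_i (x p))) // big_mkord.
apply: eq_bigr => i _; have iN := ltn_ord i.
have vi : v`_i <= v`_i.+1 by apply: v_mono; lia.
case: (leqP k i) => ki.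
  have h : x p <= v`_i by rewrite -vk v_mono // ki; lia.
  by rewrite ltNge h mulr0 !(min_idPr _) ?subrr // (le_trans h).
have h : v`_i.+1 <= x p by rewrite -vk v_mono // ki.
rewrite !(min_idPl _) ?(le_trans vi) //; case: ltP => [_|h2]; first by rewrite mulr1.
by rewrite mulr0; lra.
Qed.

(** All the [s p] are rounded with a common threshold: this correlation keeps
    the rounded difference on the two integers next to [s p - s q], so that its
    law is determined by its mean.  Allowing any enclosing [l], rather than the
    floor alone, costs nothing since both choices agree at integers. *)
Lemma integer_rounding (R : archiRealDomainType) (N : nat) (s : 'I_N -> R) :
  exists (m : nat) (w : 'I_m -> R) (a : 'I_m -> 'I_N -> int),
    (forall i, 0 <= w i) /\
    forall p q (l : int) (G : int -> R), l%:~R <= s p - s q <= (l + 1)%:~R ->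
      \sum_i w i * G (a i p - a i q) =
      (1 - (s p - s q - l%:~R)) * G l + (s p - s q - l%:~R) * G (l + 1).
Proof.
pose c p := Num.floor (s p); pose x p := s p - (c p)%:~R.
have x01 p : 0 <= x p < 1.
  by have := floor_itv (s p); rewrite rmorphD /= -/(c p) /x; lra.
have [|m [w [t [w0 w1 wx]]]] := @threshold_average R N x.
  by move=> p; have := x01 p; lra.
exists m, w, (fun i p => c p + (t i < x p)%R%:Z); split=> // p q l G.
have -> : s p - s q = (c p - c q)%:~R + (x p - x q).
  by rewrite rmorphB /= /x; ring.
rewrite addrC rmorphD /= => hl.
(* On the values actually taken by the rounded difference, [G] is affine in
   the difference of the two threshold indicators. *)
have affine (A B : R) :
    (forall i, G (c p + (t i < x p)%R%:Z - (c q + (t i < x q)%R%:Z)) =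
       A + B * ((t i < x p)%R%:R - (t i < x q)%R%:R)) ->
    \sum_i w i * G (c p + (t i < x p)%R%:Z - (c q + (t i < x q)%R%:Z)) =
      A + B * (x p - x q).
  move=> GE; under eq_bigr => i _ do rewrite GE mulrDr mulrCA mulrBr.
  by rewrite big_split /= -mulr_suml w1 mul1r -mulr_sumr sumrB !wx.
have xp := x01 p; have xq := x01 q.
have {affine} -> :
    \sum_i w i * G (c p + (t i < x p)%R%:Z - (c q + (t i < x q)%R%:Z)) =
    if x q <= x p
    then G (c p - c q) + (G (c p - c q + 1) - G (c p - c q)) * (x p - x q)
    else G (c p - c q) + (G (c p - c q) - G (c p - c q - 1)) * (x p - x q).
  case: leP => xpq; apply: affine => i.
  - have [tp|tp] := ltP (t i) (x p); have [tq|tq] := ltP (t i) (x q).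
    + by rewrite [X in G X](_ : _ = c p - c q) /=; ring.
    + by rewrite [X in G X](_ : _ = c p - c q + 1) /=; ring.
    + by have := lt_le_trans tq (le_trans xpq tp); rewrite ltxx.
    + by rewrite [X in G X](_ : _ = c p - c q) /=; ring.
  - have [tp|tp] := ltP (t i) (x p); have [tq|tq] := ltP (t i) (x q).
    + by rewrite [X in G X](_ : _ = c p - c q) /=; ring.
    + by have := lt_le_trans (lt_trans tp xpq) tq; rewrite ltxx.
    + by rewrite [X in G X](_ : _ = c p - c q - 1) /=; ring.
    + by rewrite [X in G X](_ : _ = c p - c q) /=; ring.
have [cl|cl] : l = c p - c q \/ l = c p - c q - 1.
- have lo : (l - 1)%:~R < (c p - c q)%:~R :> R by rewrite rmorphB /=; lra.
  have hi : (c p - c q)%:~R < (l + 2)%:~R :> R by rewrite rmorphD /=; lra.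
  move: lo hi; rewrite !ltr_int => lo hi.
  by case: (l =P c p - c q) => [|h]; [left|right; lia].
- rewrite cl in hl *; case: leP => xpq; first by ring.
  have -> : x p - x q = 0 by lra.
  by ring.
- rewrite cl subrK rmorphB /= in hl *; case: leP => xpq; last by ring.
  have -> : x p - x q = 0 by lra.
  by ring.
Qed.

(** Each of the [k] roundings contributes [l p q] plus a Bernoulli variable of
    parameter [s p - s q - l p q] to the difference.  The offset [b] is what
    makes the induction work: the outcome of one rounding is absorbed into it
    before the remaining ones are averaged. *)
Lemma binomial_mean_kernel (R : archiRealDomainType) (N : nat) (u s : 'I_N -> R)
    (l : 'I_N -> 'I_N -> int) (F : int -> R) :
  (forall p q, (l p q)%:~R <= s p - s q <= (l p q + 1)%:~R) ->
  (forall a : 'I_N -> int, 0 <= \sum_p \sum_q u p * F (a p - a q) * u q) ->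
  forall (k : nat) (b : 'I_N -> int),
    0 <= \sum_p \sum_q
      u p * binomial_mean k (s p - s q - (l p q)%:~R)
              (fun j => F (b p - b q + l p q *+ k + j%:Z)) * u q.
Proof.
move=> ls Fpsd; have [m [w [a [w0 wE]]]] := integer_rounding s.
elim=> [|k IHk] b.
  rewrite (eq_bigr (fun p => \sum_q u p * F (b p - b q) * u q)) // => p _.
  apply: eq_bigr => q _; rewrite /binomial_mean big_ord1 /= bin0 !expr0 !mul1r.
  by rewrite mulr0n !addr0.
suff -> : \sum_p \sum_q
      u p * binomial_mean k.+1 (s p - s q - (l p q)%:~R)
              (fun j => F (b p - b q + l p q *+ k.+1 + j%:Z)) * u q =
    \sum_i w i * \sum_p \sum_q
      u p * binomial_mean k (s p - s q - (l p q)%:~R)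
              (fun j => F ((b p + a i p) - (b q + a i q) + l p q *+ k + j%:Z)) * u q.
  by apply: sumr_ge0 => i _; rewrite mulr_ge0.
under [RHS]eq_bigr => i _ do rewrite mulr_sumr.
rewrite [RHS]exchange_big /=; apply: eq_bigr => p _.
under [RHS]eq_bigr => i _ do rewrite mulr_sumr.
rewrite [RHS]exchange_big /=; apply: eq_bigr => q _.
pose G e := binomial_mean k (s p - s q - (l p q)%:~R)
              (fun j => F (b p - b q + e + l p q *+ k + j%:Z)).
transitivity (u p * (\sum_i w i * G (a i p - a i q)) * u q); last first.
  rewrite mulr_sumr mulr_suml; apply: eq_bigr => i _.
  rewrite /G.
  rewrite [in RHS](_ : b p + a i p - (b q + a i q) = b p - b q + (a i p - a i q));
    ring.
rewrite (wE p q (l p q)) // binomial_meanS /G; congr (_ * (_ * _ + _ * _) * _);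
  apply: eq_binomial_mean => j _; congr F; rewrite mulrS ?intS; ring.
Qed.


(** Unlike [cosK], this reaches every half-turn: odd ones reflect the angle. *)
Lemma acos_cosDint (R : realType) (y : R) (l : int) : 0 <= y <= pi ->
  acos (cos (y + l%:~R * pi)) = if odd `|l| then pi - y else y.
Proof.
move=> y0pi.
have cosDnat (z : R) (k : nat) : cos (z + k%:R * pi) = (-1) ^+ k * cos z.
  by rewrite mulr_natl (alternatingn (@cosDpi R)).
have -> : cos (y + l%:~R * pi) = (-1) ^+ `|l|%N * cos y.
  case: (intP l) => [|k|k]; first by rewrite mul0r addr0 mul1r.
  - exact: cosDnat.
  - rewrite -cosN -[cos y]cosN -cosDnat abszN; congr cos.
    by rewrite rmorphN /=; ring.
have ycos : acos (cos y) = y by rewrite cosK // in_itv.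
rewrite -signr_odd; case: odd; rewrite ?mul1r // mulN1r acosN ?ycos //.
by rewrite cos_geN1 cos_le1.
Qed.

Lemma unit_circle_angle (R : realType) (z : R * R) : unit_circle z ->
  exists t : R, z = (cos t, sin t).
Proof.
case: z => x y; rewrite /unit_circle /= => xy1.
have x1 : -1 <= x <= 1.
  by have := sqr_ge0 y; nra.
have cx : cos (acos x) = x by rewrite acosK // in_itv.
have sx : sin (acos x) = `|y|.
  by rewrite sin_acos // -sqrtr_sqr; congr Num.sqrt; lra.
case: (leP 0 y) => y0.
- by exists (acos x); rewrite cx sx ger0_norm.
- by exists (- acos x); rewrite cosN sinN cx sx ltr0_norm // opprK.
Qed.

Lemma circle_dist_cos (R : realType) (s t : R) :
  circle_dist (cos s, sin s) (cos t, sin t) = acos (cos (s - t)).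
Proof. by rewrite /circle_dist /= -cosB. Qed.

(** The folding [acos \o cos] maps the period [l <= d <= l + 1] affinely onto
    [0, pi], increasing or decreasing according to the parity of [l], and maps
    the nodes [l + j / n] onto the Bernstein nodes.  The decreasing case is the
    reversal symmetry of the binomial law. *)
Lemma bernstein_acos_cos (R : realType) (n : nat) (f : R -> R) (d : R) (l : int) :
  (1 <= n)%N -> l%:~R <= d <= (l + 1)%:~R ->
  bernstein n f (acos (cos (d * pi))) =
  binomial_mean n (d - l%:~R)
    (fun j => f (acos (cos ((l *+ n + j%:Z)%:~R * (pi / n%:R))))).
Proof.
move=> n1 ld; have pi0 : 0 < pi :> R := pi_gt0 R.
have n0 : 0 < n%:R :> R by rewrite ltr0n.
pose r := d - l%:~R.
have r01 : 0 <= r <= 1 by rewrite /r; rewrite rmorphD /= in ld; lra.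
have -> : d * pi = r * pi + l%:~R * pi by rewrite /r; ring.
have node j : (j <= n)%N -> 0 <= j%:R * (pi : R) / n%:R <= pi.
  move=> jn; rewrite ler_pdivlMr // mul0r ler_pdivrMr // [pi * _]mulrC.
  by rewrite ler_pM2r // ler_nat jn mulr_ge0 ?ler0n ?pi_ge0.
rewrite acos_cosDint; last first.
  by rewrite pmulr_lge0 // ger_pMl.
have nodeE j : (j <= n)%N ->
  acos (cos ((l *+ n + j%:Z)%:~R * (pi / n%:R))) =
  if odd `|l| then (n - j)%:R * (pi : R) / n%:R else j%:R * pi / n%:R.
  move=> jn; have -> : (l *+ n + j%:Z)%:~R * (pi / n%:R) =
      j%:R * pi / n%:R + l%:~R * pi :> R.
    by rewrite rmorphD rmorphMn /= -[_ *+ n]mulr_natl; field; lra.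
  rewrite acos_cosDint ?node //; case: odd => //.
  by rewrite natrB //; field; lra.
have bernsteinE x : bernstein n f x =
  binomial_mean n (x / pi) (fun j => f (j%:R * pi / n%:R)) by [].
rewrite bernsteinE -/r; case: odd nodeE => nodeE.
- rewrite [RHS]binomial_mean_rev.
  rewrite (_ : (pi - r * pi) / pi = 1 - r); last by field; lra.
  by apply: eq_binomial_mean => j jn; rewrite nodeE ?leq_subr // subKn.
- rewrite mulfK ?gt_eqF //.
  by apply: eq_binomial_mean => j jn; rewrite nodeE.
Qed.

Lemma continuous_bernstein (R : realType) (n : nat) (f : R -> R) :
  continuous (bernstein n f).
Proof.
pose p : {poly R} := \sum_(j < n.+1)
  ('C(n, j)%:R * f (j%:R * pi / n%:R))%:P *
  ((pi^-1)%:P * 'X) ^+ j * (1 - (pi^-1)%:P * 'X) ^+ (n - j).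
rewrite (_ : bernstein n f = fun x => p.[x]); first exact: continuous_horner.
apply/funext => x; rewrite /bernstein horner_sum; apply: eq_bigr => j _.
by rewrite !hornerE [pi^-1 * x]mulrC; ring.
Qed.

Lemma quadratic_formE (R : comPzRingType) (N : nat) (A : 'M[R]_N) (u : 'rV[R]_N) :
  (u *m A *m u^T) 0 0 = \sum_p \sum_q u 0 p * A p q * u 0 q.
Proof.
rewrite mxE exchange_big /=; apply: eq_bigr => q _.
by rewrite !mxE mulr_suml.
Qed.

Theorem theorem1p2 (R : realType) (n : nat) (hn : (1 <= n)%N) (f : R -> R)
    (hf : positive_definite_S1 f) :
  positive_definite_S1 (bernstein n f).
Proof.
case: hf => _ fpsd; split.
  exact: continuous_subspaceT (@continuous_bernstein R n f).
move=> N z z1; split.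
  apply/matrixP => p q; rewrite !mxE /circle_dist.
  by congr (bernstein n f (acos _)); ring.
move=> u; have pi0 : 0 < pi :> R := pi_gt0 R.
have [t zt] := boolp.choice (fun p => unit_circle_angle (z1 p)).
pose s p := t p / pi; pose l p q := Num.floor (s p - s q).
have ls p q : (l p q)%:~R <= s p - s q <= (l p q + 1)%:~R.
  by have /andP[-> /ltW] := floor_itv (s p - s q).
pose F (a : int) := f (acos (cos (a%:~R * (pi / n%:R)))).
have Fpsd (a : 'I_N -> int) : 0 <= \sum_p \sum_q u 0 p * F (a p - a q) * u 0 q.
  pose y p := (a p)%:~R * (pi / n%:R) : R.
  have [|_ /(_ u)] := fpsd N (fun p => (cos (y p), sin (y p))).
    by move=> p; rewrite /unit_circle /= cos2Dsin2.
  rewrite quadratic_formE; congr (0 <= _).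
  apply: eq_bigr => p _; apply: eq_bigr => q _.
  by rewrite !mxE circle_dist_cos /F rmorphB /= mulrBl.
have := binomial_mean_kernel ls Fpsd n (fun=> 0).
rewrite quadratic_formE; congr (0 <= _).
apply: eq_bigr => p _; apply: eq_bigr => q _.
rewrite !mxE !zt circle_dist_cos subrr.
have -> : t p - t q = (s p - s q) * pi by rewrite /s; field; lra.
rewrite (bernstein_acos_cos _ hn (ls p q)); congr (_ * _ * _).
by apply: eq_binomial_mean => j _; rewrite add0r.
Qed.
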